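(* If $P$ is a $Q_2$-like pattern, then $\operatorname{sat}(n,P)=O(1)$ as $n\to\infty$.
   Context: All matrices are 0-1 matrices; a pattern is a 0-1 matrix. A matrix $M$ contains $P$ if some submatrix of $M$ (obtained by deleting rows and columns) can be turned into $P$ by changing some number (possibly zero) of its ones to zeroes. The weight is the number of $1$ entries. $M$ is $P$-saturated if $M$ does not contain $P$, but changing any $0$ entry of $M$ to a $1$ yields a matrix containing $P$. $\operatorname{sat}(n,P)$ is the minimum weight of an $n\times n$ $P$-saturated matrix. A pattern $P$ is called $Q_1$-like if all of the following hold. (1) $P$ contains exactly one $1$ entry in each of its top row, bottom row, first column, and last column, called $t$, $b$, $l$, $r$ respectively, and these four entries are distinct. (2) $t$ and $b$ are the only $1$ entries in their respective columns, and $l$ and $r$ are the only $1$ entries in their respective rows. (3) Either $t$ is left of $b$ and $r$ is above $l$, or $t$ is right of $b$ and $r$ is below $l$. A pattern $P$ is called $Q_2$-like if (i) $P$ has a $1$ entry in exactly one of its four corners, and (ii) the matrix obtained by deleting this $1$ entry from $P$ (i.e. changing it to $0$) is $Q_1$-like. *)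

(* Defs.v *)
From mathcomp Require Import all_boot all_order all_algebra.

Set Implicit Arguments.
Unset Strict Implicit.
Unset Printing Implicit Defensive.

(* 0-1 matrices are boolean matrices. Row 0 is the top row and column 0 the
   leftmost column, so "above" and "left of" are [<] on indices. *)

Definition incr m n (f : {ffun 'I_m -> 'I_n}) : bool :=
  [forall i : 'I_m, forall j : 'I_m, (i < j) ==> (f i < f j)].

Definition set_entry m n (M : 'M[bool]_(m, n)) (c : 'I_m * 'I_n) (v : bool)
  : 'M[bool]_(m, n) :=
  (\matrix_(i, j) if (i, j) == c then v else M i j)%R.

Definition weight m n (M : 'M[bool]_(m, n)) : nat :=
  #|[set c : 'I_m * 'I_n | M c.1 c.2]|.

(* The rows and columns that survive the deletion are the images of the
   increasing maps [f] and [g]. *)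
Definition contains m n p q (M : 'M[bool]_(m, n)) (P : 'M[bool]_(p, q)) : bool :=
  [exists f : {ffun 'I_p -> 'I_m}, exists g : {ffun 'I_q -> 'I_n},
    [&& incr f, incr g & [forall i, forall j, P i j ==> mxsub f g M i j]]].

Definition saturated m n p q (P : 'M[bool]_(p, q)) (M : 'M[bool]_(m, n)) : bool :=
  ~~ contains M P &&
  [forall c, ~~ M c.1 c.2 ==> contains (set_entry M c true) P].

(* A weight is at most [n * n], so this neutral element does not affect the
   minimum as soon as some saturated matrix exists; see [sat_min]. *)
Definition sat n p q (P : 'M[bool]_(p, q)) : nat :=
  \big[minn/n * n]_(M : 'M[bool]_n | saturated P M) weight M.

(* [t], [b] are the columns of the top and bottom entries, [l], [r] the rows
   of the left and right ones. *)
Definition Q1_like p q (P : 'M[bool]_(p.+1, q.+1)) : Prop :=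
  exists (t b : 'I_q.+1) (l r : 'I_p.+1),
  [/\ [/\ forall j, P ord0 j = (j == t),
          forall j, P ord_max j = (j == b),
          forall i, P i ord0 = (i == l)
        & forall i, P i ord_max = (i == r)],
      uniq [:: (ord0, t); (ord_max, b); (l, ord0); (r, ord_max)],
      [/\ forall i, P i t = (i == ord0),
          forall i, P i b = (i == ord_max),
          forall j, P l j = (j == ord0)
        & forall j, P r j = (j == ord_max)]
    & (t < b /\ r < l) \/ (b < t /\ l < r)].

Definition corners p q : {set 'I_p.+1 * 'I_q.+1} :=
  [set (ord0, ord0); (ord0, ord_max); (ord_max, ord0); (ord_max, ord_max)].

Definition Q2_like p q (P : 'M[bool]_(p.+1, q.+1)) : Prop :=
  exists c : 'I_p.+1 * 'I_q.+1,
  [/\ c \in corners p q,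
      forall c', c' \in corners p q -> P c'.1 c'.2 = (c' == c)
    & Q1_like (set_entry P c false)].

Lemma weight_le n (M : 'M[bool]_n) : weight M <= n * n.
Proof. by rewrite -[X in X * X]card_ord -card_prod; exact: max_card. Qed.

Lemma weight_set_entry m n (M : 'M[bool]_(m, n)) c :
  ~~ M c.1 c.2 -> weight M < weight (set_entry M c true).
Proof.
move=> Mc; apply: proper_card; apply/properP; split.
  apply/subsetP=> d; rewrite !inE mxE => Md.
  by case: ifP => // _.
exists c; rewrite !inE ?mxE //.
by case: c {Mc} => a b /=; rewrite eqxx.
Qed.

Lemma saturated_exists n p q (P : 'M[bool]_(p, q)) :
  (exists i j, P i j) -> exists M : 'M[bool]_n, saturated P M.
Proof.
move=> [i [j Pij]].
have M0 : ~~ contains (const_mx false : 'M[bool]_n) P.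
  apply/negP => /existsP[f /existsP[g /and3P[_ _ /forallP/(_ i)]]].
  by move=> /forallP/(_ j); rewrite Pij !mxE.
case: (@arg_maxnP _ _ (fun M : 'M[bool]_n => ~~ contains M P) (@weight n n) M0).
move=> M MP Mmax; exists M; rewrite /saturated MP /=.
apply/forallP=> c; apply/implyP => Mc; apply/contraT => /Mmax.
by rewrite /geq /= leqNgt (weight_set_entry Mc).
Qed.

Lemma sat_min n p q (P : 'M[bool]_(p, q)) : (exists i j, P i j) ->
  (exists2 M : 'M[bool]_n, saturated P M & weight M = sat n P) /\
  (forall M : 'M[bool]_n, saturated P M -> sat n P <= weight M).
Proof.
move=> /(saturated_exists n)[M0 M0P].
have le_sat (M : 'M[bool]_n) : saturated P M -> sat n P <= weight M.
  move=> MP; rewrite /sat; elim: (index_enum _) (mem_index_enum M) => // M' s IHs.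
  rewrite big_cons inE => /predU1P[<-|/IHs sM]; first by rewrite MP geq_minl.
  by case: ifP => // _; apply: leq_trans sM; apply: geq_minr.
split=> //.
case: (@arg_minnP _ _ (fun M : 'M[bool]_n => saturated P M) (@weight n n) M0P).
move=> M MP Mmin; exists M => //.
apply/eqP; rewrite eqn_leq le_sat // andbT.
rewrite /sat; elim/big_ind: _ => [|x y lex ley|M' /Mmin //].
  exact: weight_le.
by rewrite leq_min lex.
Qed.

(* Main.v *)
Require Import Defs.
From mathcomp Require Import all_boot all_order all_algebra.
From mathcomp Require Import zify.

(** Why the saturation function is bounded.

    It suffices to find one finite [P]-free set of points [D] with an empty
    row [e] and an empty column [c] such that putting a single point anywhere
    on row [e] or on column [c] completes a copy of [P].  Row [e] and column
    [c] can then be repeated until the matrix has size [n]: the result is still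
    [P]-free, and no one can ever be added to the repeated rows and columns.
    Saturating it only fills positions outside these rows and columns, whose
    number does not depend on [n] ([sat_le_cross]).

    Transposition and reversal of the rows preserve saturation and weight,
    and together they move the corner entry of [P] to the top left and make
    the top entry [t] lie left of the bottom entry [b], so that the right
    entry [r] lies above the left entry [l] ([bounded_corner]).

    A witness for a row alone is made of two partial copies of [P] (section
    StaircaseWitness).  On the left stands [P] without [r], with its row [r]
    on [e]: a new point of row [e] beyond this copy plays [r].  On the right
    stands [P] without [l] and without its corner, with its row [l] on [e]: a
    new point of row [e] under the left copy plays [l], provided that its
    column holds a point playing the corner.  The two copies are aligned row
    by row outside [e].  A copy of [P] with [t] and [b] on the same side would
    have to use exactly the rows of one of the two partial copies, and it
    would put its row [r] or [l] on the empty row [e]; and if [t] is on the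
    left and [b] on the right then there are too few rows.  The corners could
    spoil this count, because two of them in one row could play both the
    corner and [t].  So each column gets its corner in a row of its own, and
    these rows form a staircase which prevents a copy from using two of them.

    For the column one transposes, which puts [b] left of [t] and [l] above
    [r].  Then the left copy reaches higher than the right one, so corners in
    the top row of the right copy add no line to the count, and that one row
    can hold all of them (section FlatWitness).

    The column witness placed at the top right of the row witness gives the
    required set ([combine_witness]): a copy of [P] meeting both would have
    [t] in the former and [b] in the latter, hence [t] right of [b].

    Empty rows and columns inside [P] disturb the counting of rows.  They are
    deleted first ([compress]), and the witnesses are drawn on a grid of mesh
    [s] exceeding the dimensions of [P], so that in each copy completed by a new
    point the deleted lines find room again ([interpolate]). *)
Set Implicit Arguments.
Unset Strict Implicit.
Unset Printing Implicit Defensive.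

(** * Patterns and point sets over the natural numbers *)

Definition spaced s p (f : nat -> nat) :=
  forall x x', x < x' <= p -> f x + s <= f x'.

(** The gap [s] is [1] when copies are to be excluded, and exceeds the
    dimensions of the original matrix when copies are to be produced. *)
Definition embeds s (pat : rel nat) p q (D : rel nat) (f g : nat -> nat) :=
  [/\ spaced s p f, spaced s q g & forall x y, pat x y -> D (f x) (g y)].

Definition free (pat : rel nat) p q (D : rel nat) :=
  forall f g, ~ embeds 1 pat p q D f g.

Definition add_point (D : rel nat) e c : rel nat :=
  fun x y => D x y || (x == e) && (y == c).

(** The shape of a compressed pattern with last row [p] and last column [q]
    whose corner entry is at the top left.  The orientation of the pinwheel
    is left out, so that the notion is symmetric under transposition. *)
Record frame (pat : rel nat) p q t b l r : Prop := Frame {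
  frame_bound : forall x y, pat x y -> x <= p /\ y <= q;
  frame_row : forall x, x <= p -> exists y, pat x y;
  frame_col : forall y, y <= q -> exists x, pat x y;
  frame_corner : pat 0 0;
  frame_pt : pat 0 t;
  frame_pb : pat p b;
  frame_pl : pat l 0;
  frame_pr : pat r q;
  frame_top : forall y, pat 0 y -> y = 0 \/ y = t;
  frame_bot : forall y, pat p y -> y = b;
  frame_left : forall x, pat x 0 -> x = 0 \/ x = l;
  frame_right : forall x, pat x q -> x = r;
  frame_t : forall x, pat x t -> x = 0;
  frame_b : forall x, pat x b -> x = p;
  frame_l : forall y, pat l y -> y = 0;
  frame_r : forall y, pat r y -> y = q;
  frame_t_gt0 : 0 < t;
  frame_l_gt0 : 0 < l
}.

Lemma frame_tr (pat : rel nat) p q t b l r :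
  frame pat p q t b l r -> frame (fun x y => pat y x) q p l r t b.
Proof.
by case=> bd *; split=> // x y /bd[].
Qed.

(** No upper bound is put on the column [y] of the new point: when the set is
    placed beside another one, its row [e] crosses the columns of both. *)
Definition row_witness s pat p q X Y e (D : rel nat) :=
  [/\ forall x y, D x y -> x < X /\ y < Y,
      e < X, forall y, ~~ D e y,
      free pat p q D
    & forall y, exists f g, [/\ embeds s pat p q (add_point D e y) f g,
        f p < X & g q < maxn Y y.+1]].

Lemma spaced_le s p f x x' : spaced s p f -> x <= x' <= p -> f x <= f x'.
Proof.
move=> fs /andP[]; rewrite leq_eqVlt => /predU1P[->//|lx lp].
by have := fs x x'; rewrite lx lp => /(_ isT); lia.
Qed.

(** The counting of rows: a copy that uses only the lines [H + s * k] climbs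
    by at least one such line at each step. *)
Lemma slots_grow s H p (f : nat -> nat) i0 : 0 < s -> spaced 1 p f ->
  (forall i, i0 <= i <= p -> exists k, f i = H + s * k) ->
  forall i i' k k', i0 <= i -> i <= i' <= p ->
  f i = H + s * k -> f i' = H + s * k' -> k + (i' - i) <= k'.
Proof.
move=> s0 fs fk i + k + hi; elim=> [|i' IH] k' hi' ei ei'.
  have i0E : i = 0 by lia.
  have : s * k = s * k' by move: ei ei'; rewrite i0E; lia.
  by move/eqP; rewrite eqn_pmul2l //; lia.
have [eii|ne] := eqVneq i i'.+1.
  have : s * k = s * k' by move: ei ei'; rewrite eii; lia.
  by move/eqP; rewrite eqn_pmul2l //; lia.
have [k1 e1] := fk i' ltac:(lia).
have := IH k1 ltac:(lia) ei e1; have := fs i' i'.+1 ltac:(lia).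
rewrite ei' e1 => h.
have : k1 < k' by rewrite -(ltn_pmul2l s0); lia.
by lia.
Qed.

Definition place (pat keep : rel nat) p q (phi psi : nat -> nat) : rel nat :=
  fun x y => [exists i : 'I_p.+1, exists j : 'I_q.+1,
    [&& pat i j, keep i j, x == phi i & y == psi j]].

Lemma placeP (pat keep : rel nat) p q phi psi x y :
  place pat keep p q phi psi x y ->
  exists i j, [/\ pat i j, keep i j, x = phi i & y = psi j].
Proof.
by move=> /existsP[i /existsP[j /and4P[pij kij /eqP-> /eqP->]]]; exists i, j.
Qed.

Lemma placed (pat keep : rel nat) p q phi psi i j : i <= p -> j <= q ->
  pat i j -> keep i j -> place pat keep p q phi psi (phi i) (psi j).
Proof.
move=> ip jq pij kij; apply/existsP; exists (Ordinal (ip : i < p.+1)).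
by apply/existsP; exists (Ordinal (jq : j < q.+1)); rewrite /= pij kij !eqxx.
Qed.

(** * The row witness for a pattern with [b] left of [t] and [l] above [r] *)

Section FlatWitness.
Variables (s : nat) (pat : rel nat) (p q t b l r : nat).
Hypotheses (s_gt0 : 0 < s) (F : frame pat p q t b l r).
Hypotheses (bt : b < t) (lr : l < r).

(** In order: the pattern without [r], with its row [r] at [s * r]; the
    pattern without its first column, with its row [l] at [s * r]; and the
    corners, in the row of the top entry of the latter copy. *)
Definition flat : rel nat := fun x y =>
  [|| place pat (fun _ j => j < q) p q (fun i => s * i) (fun j => s * j) x y,
      place pat (fun _ j => 0 < j) p q (fun i => s * (i + (r - l)))
        (fun j => s * q + s * j) x y
    | (x == s * (r - l)) && (y < s * q)].

Lemma flat_row x y : flat x y -> exists2 k, x = 0 + s * k & k <> r.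
Proof.
have l0 := frame_l_gt0 F.
case/or3P=> [/placeP[i [j [pij jq -> _]]]|/placeP[i [j [pij j0 -> _]]]|/andP[/eqP-> _]].
- by exists i => // eir; move: pij; rewrite eir => /(frame_r F); lia.
- exists (i + (r - l)) => // eir; have eil : i = l by lia.
  by move: pij; rewrite eil => /(frame_l F); lia.
- by exists (r - l) => //; lia.
Qed.

Lemma flat_left x y k : flat x y -> y < s * q -> x = 0 + s * k -> k <= p.
Proof.
have [rp _] := frame_bound F (frame_pr F).
case/or3P=> [/placeP[i [j [/(frame_bound F)[ip _] jq -> _]]]
  |/placeP[i [j [_ _ _ ->]]]|/andP[/eqP-> _]].
- by move=> _ /eqP; rewrite eqn_pmul2l //; lia.
- by lia.
- by move=> _ /eqP; rewrite eqn_pmul2l //; lia.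
Qed.

Lemma flat_right x y k : flat x y -> s * q <= y -> x = 0 + s * k ->
  r - l <= k <= p + (r - l).
Proof.
case/or3P=> [/placeP[i [j [_ jq _ ->]]]|/placeP[i [j [/(frame_bound F)[ip _] _ -> _]]]|/andP[_ h]].
- by rewrite leq_pmul2l //; lia.
- by move=> _ /eqP; rewrite eqn_pmul2l //; lia.
- by lia.
Qed.

(** If [t] and [b] both lie on the left then the copy fills the lines
    [0, ..., p] and puts its row [r] on the empty line [r]; if both lie on the
    right then it fills those of the right half and puts its row [l] there.
    With [t] right and [b] left there are fewer than [p + 1] lines between them,
    and [b] left of [t] excludes the last case. *)
Lemma flat_free : free pat p q flat.
Proof.
have [rp _] := frame_bound F (frame_pr F).
have [_ tq] := frame_bound F (frame_pt F).
have [lp _] := frame_bound F (frame_pl F).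
move=> f g [fs gs fg].
have fk i : 0 <= i <= p -> exists2 k, f i = 0 + s * k & k <> r.
  by case/andP=> _ /(frame_row F)[y /fg/flat_row].
have [k0 e0 _] := fk 0 isT.
have [kp ep _] := fk p ltac:(lia).
have [kr er nr] := fk r ltac:(lia).
have [kl el nl] := fk l ltac:(lia).
have grow := slots_grow s_gt0 fs (i0 := 0) (H := 0)
  (fun i hi => let: ex_intro2 k e _ := fk i hi in ex_intro _ k e).
have gbt : g b < g t by have := gs b t; lia.
have hr1 := grow 0 r k0 kr isT ltac:(lia) e0 er.
have hr2 := grow r p kr kp isT ltac:(lia) er ep.
have hl1 := grow 0 l k0 kl isT ltac:(lia) e0 el.
have hl2 := grow l p kl kp isT ltac:(lia) el ep.
have Dt := fg _ _ (frame_pt F); have Db := fg _ _ (frame_pb F).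
case: (ltnP (g b) (s * q)) => gb.
  have := flat_left Db gb ep; case: (ltnP (g t) (s * q)) => gt; first by lia.
  by have := flat_right Dt gt e0; lia.
have := flat_right Db gb ep.
by have := flat_right Dt ltac:(lia) e0; lia.
Qed.

Lemma flat_row_witness : exists X Y e D, row_witness s pat p q X Y e D.
Proof.
have [rp q0'] := frame_bound F (frame_pr F).
have [_ tq] := frame_bound F (frame_pt F).
have [lp _] := frame_bound F (frame_pl F).
have l0 := frame_l_gt0 F.
exists (s * (p + (r - l))).+1, (s * q + s * q).+1, (s * r), flat; split.
- move=> x y /or3P[/placeP[i [j [/(frame_bound F)[ip jq] _ -> ->]]]
    |/placeP[i [j [/(frame_bound F)[ip jq] _ -> ->]]]|/andP[/eqP-> h]];
  by rewrite !ltnS -?mulnDr ?leq_pmul2l //; split=> //; nia.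
- by rewrite ltnS leq_pmul2l //; lia.
- move=> y; apply/negP => /flat_row[k] /eqP; rewrite eqn_pmul2l //; lia.
- exact: flat_free.
move=> y; case: (ltnP y (s * q)) => hy.
  exists (fun i => s * (i + (r - l))), (fun j => if j == 0 then y else s * q + s * j).
  split; last 2 first.
  - by [].
  - by case: eqP; lia.
  split; first by move=> x x' h; nia.
    by move=> j j' h; case: eqP => [?|?]; case: eqP => [?|?]; nia.
  move=> i j pij; have [ip jq] := frame_bound F pij; rewrite /add_point.
  case: eqP => [ej|ej].
    move: pij; rewrite ej => /(frame_left F)[->|->].
      by apply/orP; left; apply/or3P; constructor 3; rewrite add0n eqxx.
    by rewrite eqxx andbT; apply/orP; right; apply/eqP; congr (_ * _); lia.
  apply/orP; left; apply/or3P; constructor 2.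
  by apply: (placed (fun i => s * (i + (r - l))) (fun j => s * q + s * j)) => //; lia.
exists (fun i => s * i), (fun j => if j == q then y else s * j).
split; last 2 first.
- by rewrite ltnS leq_pmul2l //; lia.
- by rewrite eqxx; lia.
split; first by move=> x x' h; nia.
  by move=> j j' h; case: eqP => [?|?]; case: eqP => [?|?]; nia.
move=> i j pij; have [ip jq] := frame_bound F pij; rewrite /add_point.
case: eqP => [ej|ej].
  by move: pij; rewrite ej => /(frame_right F)->; rewrite !eqxx orbT.
apply/orP; left; apply/or3P; constructor 1.
by apply: (placed (fun i => s * i) (fun j => s * j)) => //; lia.
Qed.

End FlatWitness.

(** * The row witness for a pattern with [t] left of [b] and [r] above [l] *)

Section StaircaseWitness.
Variables (s : nat) (pat : rel nat) (p q t b l r : nat).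
Hypotheses (s_gt0 : 0 < s) (F : frame pat p q t b l r).
Hypotheses (tb : t < b) (rl : r < l).

(** Below row [s * q]: the pattern without [r] on the left, and the pattern
    without its first row and column on the right, with the rows [r] and [l]
    respectively at [s * q + s * l].  Each row above holds the corner of
    one left column together with a copy of [t]; the corners rise from left
    to right. *)
Definition staircase : rel nat := fun x y =>
  [|| place pat (fun _ j => j < q) p q (fun i => s * q + s * (i + (l - r)))
        (fun j => s * j) x y,
      place pat (fun i j => (0 < i) && (0 < j)) p q (fun i => s * q + s * i)
        (fun j => s * q + s * j) x y
    | (x < s * q) && ((y == (s * q).-1 - x) || (y == s * q + s * t))].

Lemma staircase_low x y : staircase x y -> s * q <= x ->
  exists k, [/\ x = s * q + s * k, 0 < k & k <> l].
Proof.
case/or3P=> [/placeP[i [j [pij jq -> _]]]|/placeP[i [j [pij /andP[i0 j0] -> _]]]|/andP[h _]] hx.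
- exists (i + (l - r)); split; [by []|by lia|] => eir; have eil : i = r by lia.
  by move: pij; rewrite eil => /(frame_r F); lia.
- exists i; split=> // eil.
  by move: pij; rewrite eil => /(frame_l F); lia.
- by lia.
Qed.

Lemma staircase_left x y k : staircase x y -> y < s * q -> x = s * q + s * k ->
  l - r <= k <= p + (l - r).
Proof.
case/or3P=> [/placeP[i [j [/(frame_bound F)[ip _] jq -> _]]]|/placeP[i [j [_ _ _ ->]]]|/andP[h _]].
- by move=> _ /addnI/eqP; rewrite eqn_pmul2l //; lia.
- by lia.
- by lia.
Qed.

Lemma staircase_right x y k : staircase x y -> s * q <= y -> x = s * q + s * k -> k <= p.
Proof.
case/or3P=> [/placeP[i [j [_ jq _ ->]]]|/placeP[i [j [/(frame_bound F)[ip _] _ -> _]]]|/andP[h _]].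
- by rewrite leq_pmul2l //; lia.
- by move=> _ /addnI/eqP; rewrite eqn_pmul2l //; lia.
- by lia.
Qed.

Lemma staircase_top x y : staircase x y -> x < s * q ->
  y = (s * q).-1 - x \/ y = s * q + s * t.
Proof.
case/or3P=> [/placeP[i [j [_ _ -> _]]]|/placeP[i [j [_ _ -> _]]]|/andP[_ /orP[]/eqP->]].
- by rewrite ltnNge leq_addr.
- by rewrite ltnNge leq_addr.
- by left.
- by right.
Qed.

(** If the copy starts in the staircase then its corner and [t] must be the two
    points of one staircase row.  The lower staircase rows have their corner
    further left, so they offer no point to the other rows of the copy, which
    then has to fit the lines of the right half and puts its row [l] on the empty
    line [l].  If it starts lower then the lines are counted, as for the other
    orientation. *)
Lemma staircase_free : free pat p q staircase.
Proof.
have [lp _] := frame_bound F (frame_pl F).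
have [_ bq] := frame_bound F (frame_pb F).
have t0 := frame_t_gt0 F.
move=> f g [fs gs fg].
have Dc := fg _ _ (frame_corner F); have Dt := fg _ _ (frame_pt F).
have Db := fg _ _ (frame_pb F).
have gt : g 0 < g t by have := gs 0 t; lia.
have gb : g t < g b by have := gs t b; lia.
have fk i : i <= p -> s * q <= f i ->
    exists k, [/\ f i = s * q + s * k, 0 < k & k <> l].
  by move=> /(frame_row F)[y /fg/staircase_low].
case: (ltnP (f 0) (s * q)) => f0.
  have gtE : g t = s * q + s * t.
    by have := staircase_top Dc f0; have := staircase_top Dt f0; lia.
  have g0E : g 0 = (s * q).-1 - f 0 by have := staircase_top Dc f0; lia.
  have hi i : 0 < i -> i <= p -> s * q <= f i.
    move=> i0 ip; rewrite leqNgt; apply/negP => fi.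
    have [y py] := frame_row F ip; have [_ yq] := frame_bound F py.
    have f0i : f 0 < f i by have := fs 0 i; lia.
    have gy0 : g 0 <= g y by apply: (spaced_le gs); lia.
    case: (staircase_top (fg _ _ py) fi) => gy; first by lia.
    case: (ltngtP y t) => [yt|yt|yt].
    - by have := gs y t; lia.
    - by have := gs t y; lia.
    - by move: py; rewrite yt => /(frame_t F); lia.
  have grow := slots_grow s_gt0 fs (i0 := 1) (H := s * q) (fun i h =>
    let: ex_intro k (And3 e _ _) := fk i ltac:(lia) (hi i ltac:(lia) ltac:(lia))
    in ex_intro _ k e).
  have [k1 [e1 k1_0 _]] := fk 1 ltac:(lia) (hi 1 isT ltac:(lia)).
  have [kl [el _ nl]] := fk l lp (hi l ltac:(lia) lp).
  have [kp [ep _ _]] := fk p (leqnn p) (hi p ltac:(lia) (leqnn p)).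
  have := grow 1 l k1 kl isT ltac:(lia) e1 el.
  have := grow l p kl kp ltac:(lia) ltac:(lia) el ep.
  by have := staircase_right Db ltac:(lia) ep; lia.
have hi i : i <= p -> s * q <= f i.
  by move=> ip; apply: leq_trans f0 _; apply: (spaced_le fs).
have grow := slots_grow s_gt0 fs (i0 := 0) (H := s * q) (fun i h =>
    let: ex_intro k (And3 e _ _) := fk i ltac:(lia) (hi i ltac:(lia))
    in ex_intro _ k e).
have [k0 [e0 k0_0 _]] := fk 0 isT f0.
have [kr [er _ nr]] := fk r ltac:(lia) (hi r ltac:(lia)).
have [kp [ep _ _]] := fk p (leqnn p) (hi p (leqnn p)).
have h1 := grow 0 r k0 kr isT ltac:(lia) e0 er.
have h2 := grow r p kr kp isT ltac:(lia) er ep.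
(* The right half has no line below [p], the left half none above [l - r]. *)
case: (ltnP (g b) (s * q)) => hb.
  have := staircase_left Db hb ep; have := staircase_left Dt ltac:(lia) e0; lia.
by have := staircase_right Db hb ep; lia.
Qed.

Lemma staircase_row_witness : exists X Y e D, row_witness s pat p q X Y e D.
Proof.
have [lp _] := frame_bound F (frame_pl F).
have [_ bq] := frame_bound F (frame_pb F).
have t0 := frame_t_gt0 F.
have sl : s * q + s * (p + (l - r)) = s * (q + p + (l - r)) by nia.
exists (s * q + s * (p + (l - r))).+1, (s * q + s * q).+1, (s * q + s * l), staircase.
split.
- move=> x y /or3P[/placeP[i [j [/(frame_bound F)[ip jq] _ -> ->]]]
    |/placeP[i [j [/(frame_bound F)[ip jq] _ -> ->]]]|/andP[h /orP[]/eqP->]];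
  by split; nia.
- by nia.
- move=> y; apply/negP => /staircase_low[] => [|k []]; first by nia.
  by move=> /addnI/eqP; rewrite eqn_pmul2l //; lia.
- exact: staircase_free.
move=> y; case: (ltnP y (s * q)) => hy.
  exists (fun i => if i == 0 then (s * q).-1 - y else s * q + s * i),
    (fun j => if j == 0 then y else s * q + s * j).
  split; last 2 first.
  - by case: eqP; nia.
  - by case: eqP; nia.
  split.
  - by move=> j j' h; case: eqP => [?|?]; case: eqP => [?|?]; nia.
  - by move=> j j' h; case: eqP => [?|?]; case: eqP => [?|?]; nia.
  move=> i j pij; have [ip jq] := frame_bound F pij; rewrite /add_point.
  case: (eqVneq i 0) => [ei|ei].
    apply/orP; left; apply/or3P; constructor 3.
    move: pij; rewrite ei => /(frame_top F)[->|->] /=; first by apply/andP; lia.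
    by rewrite (gtn_eqF t0) eqxx orbT andbT; lia.
  case: (eqVneq j 0) => [ej|ej].
    move: pij; rewrite ej => /(frame_left F)[i0|->]; first by rewrite i0 eqxx in ei.
    by rewrite !eqxx orbT.
  apply/orP; left; apply/or3P; constructor 2.
  by apply: (placed (fun i => s * q + s * i) (fun j => s * q + s * j)) => //; lia.
exists (fun i => s * q + s * (i + (l - r))), (fun j => if j == q then y else s * j).
split; last 2 first.
- by rewrite ltnS.
- by rewrite eqxx; lia.
split; first by move=> x x' h; nia.
  by move=> j j' h; case: eqP => [?|?]; case: eqP => [?|?]; nia.
move=> i j pij; have [ip jq] := frame_bound F pij; rewrite /add_point.
case: eqP => [ej|ej].
  move: pij; rewrite ej => /(frame_right F)->; apply/orP; right.
  by rewrite eqxx andbT; apply/eqP; congr (_ + _ * _); lia.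
apply/orP; left; apply/or3P; constructor 1.
by apply: (placed (fun i => s * q + s * (i + (l - r))) (fun j => s * j)) => //; lia.
Qed.

End StaircaseWitness.

(** * A row and a column at once *)

Definition cross_witness s pat p q X Y e c (D : rel nat) :=
  [/\ [/\ forall x y, D x y -> x < X /\ y < Y, e < X & c < Y],
      (forall y, ~~ D e y) /\ (forall x, ~~ D x c),
      free pat p q D,
      forall y, y < Y -> exists f g,
        [/\ embeds s pat p q (add_point D e y) f g, f p < X & g q < Y]
    & forall x, x < X -> exists f g,
        [/\ embeds s pat p q (add_point D x c) f g, f p < X & g q < Y]].

Lemma spaced_add s p f c : spaced s p f -> spaced s p (fun x => c + f x).
Proof. by move=> fs x x' /fs; lia. Qed.

Lemma spaced_sub s p f c : (forall x, x <= p -> c <= f x) ->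
  spaced s p f -> spaced s p (fun x => f x - c).
Proof. by move=> fc fs x x' h; have := fs x x' h; have := fc x ltac:(lia); lia. Qed.

(** The column witness occupies the rows before [Y'] and the columns from [Y] on,
    the row witness the rows from [Y'] on and the columns before [Y].  A copy
    not contained in the column witness has [b], hence [t], among the columns
    of the row witness, so that all its rows are there too. *)
Lemma combine_witness s pat p q t b l r :
  frame pat p q t b l r -> t < b ->
  forall X Y e D, row_witness s pat p q X Y e D ->
  forall X' Y' e' D', row_witness s (fun x y => pat y x) q p X' Y' e' D' ->
  cross_witness s pat p q (Y' + X) (Y + X') (Y' + e) (Y + e')
    (fun x y => (Y' <= x) && D (x - Y') y || (Y <= y) && D' (y - Y) x).
Proof.
move=> F tb X Y e D [DXY eX De Dfree Dadd] X' Y' e' D' [DXY' eX' De' Dfree' Dadd'].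
split.
- split; [move=> x y|by lia|by lia].
  by case/orP=> /andP[h]; [move=> /DXY|move=> /DXY'] => -[]; lia.
- split=> [y|x]; rewrite negb_or !negb_and.
    rewrite addKn De orbT /=; case: (boolP (D' (y - Y) _)) => [/DXY'[]|]; first by lia.
    by rewrite orbT.
  rewrite addKn De' orbT andbT; case: (boolP (D _ _)) => [/DXY[]|]; first by lia.
  by rewrite orbT.
- have [_ bq] := frame_bound F (frame_pb F).
  move=> f g [fs gs fg].
  have Dc := fg _ _ (frame_corner F); have Dt := fg _ _ (frame_pt F).
  have Db := fg _ _ (frame_pb F); have gtb : g t < g b by have := gs t b; lia.
  case: (ltnP (f p) Y') => fp.
    have fY i : i <= p -> f i < Y'.
      by move=> ip; apply: leq_ltn_trans fp; apply: (spaced_le fs); lia.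
    have gY : Y <= g 0.
      by case/orP: Dc => /andP[h]; [have := fY 0 isT; lia|].
    apply: (Dfree' (fun j => g j - Y) f); split=> //.
      by apply: spaced_sub => // j jq; apply: leq_trans gY _; apply: (spaced_le gs).
    move=> j i pij; have [ip _] := frame_bound F pij.
    by case/orP: (fg _ _ pij) => /andP[h] //; have := fY i ip; lia.
  have gbY : g b < Y.
    by case/orP: Db => /andP[h]; [case/DXY|case/DXY'; lia].
  have f0 : Y' <= f 0 by case/orP: Dt => /andP[h] // _; lia.
  have fY i : i <= p -> Y' <= f i.
    by move=> ip; apply: leq_trans f0 _; apply: (spaced_le fs).
  apply: (Dfree (fun i => f i - Y') g); split=> //; first exact: spaced_sub.
  move=> i j pij; have [ip _] := frame_bound F pij.
  case/orP: (fg _ _ pij) => /andP[h] // /DXY'[_]; have := fY i ip; lia.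
- move=> y yY; have [f [g [[fs gs fg] fp gq]]] := Dadd y.
  exists (fun i => Y' + f i), g; split; [split=> //|by lia|by lia].
    exact: spaced_add.
  move=> i j /fg /orP[h|/andP[/eqP-> /eqP->]]; last by rewrite /add_point !eqxx orbT.
  by rewrite /add_point leq_addr addKn h.
- move=> x xX; have [f [g [[fs gs fg] fp gq]]] := Dadd' x.
  exists g, (fun i => Y + f i); split; [split=> //|by lia|by lia].
    exact: spaced_add.
  move=> i j /fg /orP[h|/andP[/eqP-> /eqP->]]; last by rewrite /add_point !eqxx orbT.
  by rewrite /add_point leq_addr addKn h orbT.
Qed.

Lemma cross_witness_exists s pat p q t b l r : 0 < s ->
  frame pat p q t b l r -> t < b -> r < l ->
  exists X Y e c D, cross_witness s pat p q X Y e c D.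
Proof.
move=> s0 F tb rl.
have [X [Y [e [D W]]]] := staircase_row_witness s0 F tb rl.
have [X' [Y' [e' [D' W']]]] := flat_row_witness s0 (frame_tr F) rl tb.
by do 5 eexists; exact: (combine_witness F tb W W').
Qed.

(** * Repeating a line *)

(** Maps each line to the line that it repeats, when [d] extra copies of line
    [e] are inserted. *)
Definition collapse e d i := if i <= e then i else maxn e (i - d).

(** The section of [collapse] that represents line [e] by its copy [i0]. *)
Definition lift_slot e d i0 x := if x < e then x else if x == e then i0 else x + d.

Lemma collapse_lt e d i i' : i < i' -> collapse e d i != e -> collapse e d i' != e ->
  collapse e d i < collapse e d i'.
Proof. rewrite /collapse; case: (leqP i e) => ?; case: (leqP i' e) => ?; lia. Qed.

Lemma collapse_inj e d i i' : collapse e d i != e -> collapse e d i' != e ->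
  collapse e d i = collapse e d i' -> i = i'.
Proof. rewrite /collapse; case: (leqP i e) => ?; case: (leqP i' e) => ?; lia. Qed.

Lemma collapse_bound e X n i : e < X -> X <= n -> i < n -> collapse e (n - X) i < X.
Proof. by rewrite /collapse; case: (leqP i e); lia. Qed.

Lemma lift_slotK e d i x : (collapse e d i = e) -> collapse e d (lift_slot e d i x) = x.
Proof.
rewrite /lift_slot; case: (ltnP x e) => h.
  by rewrite /collapse; case: (leqP x e); lia.
by case: eqP => [->//|ne] _; rewrite /collapse; case: (leqP (x + d) e); lia.
Qed.

Lemma collapseK e d i :
  lift_slot e d (if collapse e d i == e then i else e) (collapse e d i) = i.
Proof.
rewrite /lift_slot; case: eqP => [->|]; first by rewrite ltnn.
by rewrite /collapse; case: (leqP i e) => h ne; case: ltnP => h'; lia.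
Qed.

Lemma lift_slot_spaced e d i s p f : (collapse e d i = e) -> spaced s p f ->
  spaced s p (fun x => lift_slot e d i (f x)).
Proof.
move=> he fs x x' /fs; move: he; rewrite /collapse /lift_slot.
case: (leqP i e) => h.
  by case: (ltngtP (f x) e) => ?; case: (ltngtP (f x') e) => ?; lia.
by case: (ltngtP (f x) e) => ?; case: (ltngtP (f x') e) => ?; lia.
Qed.

Lemma lift_slot_bound e X n i x : e < X -> X <= n -> i < n -> x < X ->
  lift_slot e (n - X) i x < n.
Proof. by rewrite /lift_slot; case: (ltnP x e) => ?; [|case: (eqVneq x e) => ?]; lia. Qed.

(** * Deleting and restoring empty rows and columns *)

Definition enumerates n (S : pred 'I_n.+1) p (u : nat -> 'I_n.+1) :=
  [/\ u 0 = ord0, u p = ord_max,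
      forall x x', x < x' <= p -> u x < u x',
      forall x, x <= p -> S (u x)
    & forall i, S i -> exists2 x, x <= p & u x = i].

Lemma enumerates_exists n (S : pred 'I_n.+1) : S ord0 -> S ord_max ->
  exists p u, enumerates S p u.
Proof.
move=> S0 Sn; pose e : seq 'I_n.+1 := enum S.
have e_sorted : sorted ltn [seq val i | i <- e].
  have -> : [seq val i | i <- e] = filter (fun k => [exists i, S i && (val i == k)]) (iota 0 n.+1).
    rewrite -val_enum_ord filter_map /e enumT /enum_mem; congr map.
    apply: eq_filter => i /=; apply/idP/existsP => [Si|[j /andP[Sj /eqP/val_inj <-]]] //.
    by exists i; rewrite eqxx andbT.
  by apply: sorted_filter (iota_ltn_sorted _ _) => ? ? ?; apply: ltn_trans.
have e_mem i : (i \in e) = S i by rewrite mem_enum.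
have e_gt0 : 0 < size e by rewrite -has_predT; apply/hasP; exists ord0; rewrite ?e_mem.
have [p sizeE] : exists p, size e = p.+1 by exists (size e).-1; rewrite prednK.
have u_lt x x' : x < x' <= p -> nth ord0 e x < nth ord0 e x'.
  have nthE k : k <= p -> nth ord0 e k = nth 0 [seq val i | i <- e] k :> nat.
    by move=> ke; rewrite (nth_map ord0) ?sizeE.
  move=> h; rewrite !nthE; try lia.
  by apply: (sorted_ltn_nth ltn_trans 0 e_sorted); rewrite ?inE ?size_map ?sizeE; lia.
have u_onto i : S i -> exists2 x, x <= p & nth ord0 e x = i.
  rewrite -e_mem => ie; exists (index i e); last exact: nth_index.
  by rewrite -ltnS -sizeE index_mem.
exists p, (nth ord0 e); split=> //.
- have [x hx e0] := u_onto _ S0; case: (posnP x) => [xe|x0]; first by rewrite -{1}xe.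
  by have := u_lt 0 x ltac:(lia); rewrite e0.
- have [x hx en] := u_onto _ Sn; have [<-//|ne] := eqVneq x p.
  by have := u_lt x p ltac:(lia); rewrite en /= ltnNge leq_ord.
- by move=> x hx; rewrite -e_mem mem_nth // sizeE.
Qed.

(** Positions for the nonempty lines with gaps larger than [n] extend to all
    lines: an empty line is put as far behind the preceding nonempty line as in
    the pattern. *)
Lemma interpolate n (S : pred 'I_n.+1) p u s f : enumerates S p u -> n < s ->
  spaced s p f ->
  exists F : 'I_n.+1 -> nat, [/\ forall i i' : 'I_n.+1, i < i' -> F i < F i',
    forall x, x <= p -> F (u x) = f x & forall i, F i <= f p].
Proof.
move=> [u0 up u_lt _ _] ns fs.
(* The maximum is attained at the last [x] with [u x <= i], thanks to the gaps. *)
pose F (i : 'I_n.+1) := \max_(x < p.+1 | u x <= i) (f x + (i - u x)).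
have F_ge x (i : 'I_n.+1) : x <= p -> u x <= i -> f x + (i - u x) <= F i.
  move=> xp ui; exact: (@leq_bigmax_cond _ (fun x : 'I_p.+1 => u x <= i)
    (fun x : 'I_p.+1 => f x + (i - u x)) (Ordinal (xp : x < p.+1))).
have Fu x : x <= p -> F (u x) = f x.
  move=> xp; apply/eqP; rewrite eqn_leq; apply/andP; split; last first.
    by have := F_ge x (u x) xp (leqnn _); lia.
  apply/bigmax_leqP => -[x' /= x'p] ux'.
  case: (ltngtP x' x) => [xx|xx|->]; last by lia.
    by have := fs x' x ltac:(lia); have := ltn_ord (u x); lia.
  by have := u_lt x x' ltac:(lia); lia.
have F_lt (i i' : 'I_n.+1) : i < i' -> F i < F i'.
  move=> ii; have F0 : 0 < F i' by have := F_ge 0 i' isT; rewrite u0 /=; lia.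
  rewrite -(prednK F0) ltnS; apply/bigmax_leqP => -[x /= xp] ux.
  by have := F_ge x i' ltac:(lia) ltac:(lia); lia.
exists F; split=> // i; rewrite -(Fu p (leqnn _)) up.
have := leq_ord i; rewrite leq_eqVlt => /predU1P[e|ltin]; last exact/ltnW/F_lt.
by have -> : i = ord_max by apply: val_inj.
Qed.

Definition nonempty_row m n (P : 'M[bool]_(m, n)) : pred 'I_m :=
  fun i => [exists j, P i j].

Definition nonempty_col m n (P : 'M[bool]_(m, n)) : pred 'I_n :=
  fun j => [exists i, P i j].

Definition compress m n (P : 'M[bool]_(m, n)) p q (u : nat -> 'I_m) (v : nat -> 'I_n)
  : rel nat := fun x y => [&& x <= p, y <= q & P (u x) (v y)].

Lemma containsI m n p q (M : 'M[bool]_(m, n)) (P : 'M[bool]_(p, q))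
    (f : 'I_p -> 'I_m) (g : 'I_q -> 'I_n) :
  (forall i i' : 'I_p, i < i' -> f i < f i') ->
  (forall j j' : 'I_q, j < j' -> g j < g j') ->
  (forall i j, P i j -> M (f i) (g j)) -> contains M P.
Proof.
move=> fi gi fg; apply/existsP; exists (finfun f); apply/existsP; exists (finfun g).
apply/and3P; split.
- by apply/forallP=> i; apply/forallP=> i'; apply/implyP; rewrite !ffunE; apply: fi.
- by apply/forallP=> i; apply/forallP=> i'; apply/implyP; rewrite !ffunE; apply: gi.
- apply/forallP=> i; apply/forallP=> j; apply/implyP; rewrite mxE !ffunE; exact: fg.
Qed.

Lemma containsE m n p q (M : 'M[bool]_(m, n)) (P : 'M[bool]_(p, q)) :
  contains M P -> exists (f : 'I_p -> 'I_m) (g : 'I_q -> 'I_n),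
  [/\ forall i i' : 'I_p, i < i' -> f i < f i',
      forall j j' : 'I_q, j < j' -> g j < g j'
    & forall i j, P i j -> M (f i) (g j)].
Proof.
move=> /existsP[f /existsP[g /and3P[/forallP fi /forallP gi /forallP fg]]].
exists f, g; split=> [i i'|j j'|i j].
- by have /forallP/(_ i')/implyP := fi i.
- by have /forallP/(_ j')/implyP := gi j.
- by have /forallP/(_ j)/implyP := fg i; rewrite mxE.
Qed.

(** * From witnesses to saturated matrices *)

Lemma saturate m n p q (P : 'M[bool]_(p, q)) (M : 'M[bool]_(m, n)) :
  ~~ contains M P ->
  exists2 M', saturated P M' & forall i j, M i j -> M' i j.
Proof.
move=> MP; pose ok (N : 'M[bool]_(m, n)) :=
  ~~ contains N P && [forall i, forall j, M i j ==> N i j].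
have okM : ok M by rewrite /ok MP; apply/forallP=> i; apply/forallP=> j; apply/implyP.
case: (arg_maxnP (@weight m n) okM) => N /andP[NP /forallP MN] Nmax.
have sub i j : M i j -> N i j by have /forallP/(_ j)/implyP := MN i.
exists N => //; rewrite /saturated NP /=; apply/forallP=> c; apply/implyP => Nc.
apply/contraT => cP; have := weight_set_entry Nc; rewrite ltnNge => /negP[]; apply: Nmax.
rewrite /ok cP; apply/forallP=> i; apply/forallP=> j; apply/implyP => /sub Nij.
by rewrite mxE; case: ifP.
Qed.

Section Stretch.
Variables (m k : nat) (P : 'M[bool]_(m.+1, k.+1)).
Variables (p q : nat) (u : nat -> 'I_m.+1) (v : nat -> 'I_k.+1).
Hypotheses (Hu : enumerates (nonempty_row P) p u).
Hypotheses (Hv : enumerates (nonempty_col P) q v).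
Notation pat := (compress P p q u v).

Lemma contains_spaced s n1 n2 (M : 'M[bool]_(n1, n2)) E f g : m < s -> k < s ->
  embeds s pat p q E f g -> f p < n1 -> g q < n2 ->
  (forall (i : 'I_n1) (j : 'I_n2), E i j -> M i j) -> contains M P.
Proof.
move=> ms ks [fs gs fg] fn gn sub.
have [G [Gi Gu Gb]] := interpolate Hu ms fs.
have [K [Ki Ku Kb]] := interpolate Hv ks gs.
have [_ _ _ _ u_onto] := Hu; have [_ _ _ _ v_onto] := Hv.
have Gn i : G i < n1 by apply: leq_ltn_trans fn.
have Kn i : K i < n2 by apply: leq_ltn_trans gn.
apply: (@containsI _ _ _ _ _ _ (fun i => Ordinal (Gn i)) (fun j => Ordinal (Kn j))) => //.
move=> i j Pij; apply: sub => /=.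
have [x xp ux] : exists2 x, x <= p & u x = i.
  by apply: u_onto; apply/existsP; exists j.
have [y yq vy] : exists2 y, y <= q & v y = j.
  by apply: v_onto; apply/existsP; exists i.
by rewrite -ux -vy Gu // Ku //; apply: fg; rewrite /compress xp yq ux vy.
Qed.

(** A saturated matrix above the stretched witness has no one in the stretched
    rows and columns, and [collapse] is injective elsewhere. *)
Lemma sat_le_cross s X Y e c D : m < s -> k < s ->
  cross_witness s pat p q X Y e c D ->
  forall n, X <= n -> Y <= n -> sat n P <= X * Y.
Proof.
move=> ms ks [[DXY eX cY] [De Dc] Dfree Drow Dcol] n Xn Yn.
have [u0 up u_lt u_S u_onto] := Hu; have [v0 vq v_lt v_S v_onto] := Hv.
pose M : 'M[bool]_n := (\matrix_(i, j) D (collapse e (n - X) i) (collapse c (n - Y) j))%R.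
have M_free : ~~ contains M P.
  apply/negP => /containsE[f [g [fi gi fg]]].
  have rows x : x <= p -> collapse e (n - X) (f (u x)) != e.
    move=> /u_S/existsP[j /fg]; rewrite mxE => h; apply/eqP => ee.
    by move: h; rewrite ee (negbTE (De _)).
  have cols y : y <= q -> collapse c (n - Y) (g (v y)) != c.
    move=> /v_S/existsP[i /fg]; rewrite mxE => h; apply/eqP => ee.
    by move: h; rewrite ee (negbTE (Dc _)).
  apply: (Dfree (fun x => collapse e (n - X) (f (u x)))
                (fun y => collapse c (n - Y) (g (v y)))); split.
  - move=> x x' h; rewrite addn1; apply: collapse_lt; try (apply: rows; lia).
    by apply/fi/u_lt.
  - move=> x x' h; rewrite addn1; apply: collapse_lt; try (apply: cols; lia).
    by apply/gi/v_lt.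
  - by move=> x y /and3P[_ _ /fg]; rewrite mxE.
have [N Nsat MN] := saturate M_free.
have /andP[NP _] := Nsat.
have lift (i j : 'I_n) f g : N i j ->
    embeds s pat p q (add_point D (collapse e (n - X) i) (collapse c (n - Y) j)) f g ->
    f p < X -> g q < Y -> False.
  (* A copy using the new point must represent line [e] by [i] when [i] is one of
     its repetitions; otherwise any representative will do. *)
  pose i0 := if collapse e (n - X) i == e then i : nat else e.
  pose j0 := if collapse c (n - Y) j == c then j : nat else c.
  move=> Nij [fs gs fg] fX gY; case/negP: NP.
  have i0n : i0 < n by rewrite /i0; case: ifP => _ //; lia.
  have j0n : j0 < n by rewrite /j0; case: ifP => _ //; lia.
  have ci0 : collapse e (n - X) i0 = e.
    by rewrite /i0; case: eqP => //; rewrite /collapse leqnn.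
  have cj0 : collapse c (n - Y) j0 = c.
    by rewrite /j0; case: eqP => //; rewrite /collapse leqnn.
  apply: (@contains_spaced s n n N
    (fun x y => D (collapse e (n - X) x) (collapse c (n - Y) y) || (x == i) && (y == j))
    (fun x => lift_slot e (n - X) i0 (f x)) (fun y => lift_slot c (n - Y) j0 (g y))) => //.
  - split; [exact: lift_slot_spaced|exact: lift_slot_spaced|].
    move=> x y /fg; rewrite /add_point !lift_slotK // => /orP[->//|/andP[/eqP-> /eqP->]].
    apply/orP; right; apply/andP; split.
      by rewrite /i0 collapseK.
    by rewrite /j0 collapseK.
  - exact: lift_slot_bound.
  - exact: lift_slot_bound.
  - move=> x y /orP[h|/andP[/eqP/val_inj-> /eqP/val_inj->]] //.
    by apply: MN; rewrite mxE.
have Ne i j : N i j -> collapse e (n - X) i != e.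
  move=> Nij; apply/eqP => ie.
  have [f [g [E fX gY]]] := Drow (collapse c (n - Y) j) (collapse_bound cY Yn (ltn_ord j)).
  by apply: (lift i j f g Nij) => //; rewrite ie.
have Nc i j : N i j -> collapse c (n - Y) j != c.
  move=> Nij; apply/eqP => ie.
  have [f [g [E fX gY]]] := Dcol (collapse e (n - X) i) (collapse_bound eX Xn (ltn_ord i)).
  by apply: (lift i j f g Nij) => //; rewrite ie.
have P_ex : exists i j, P i j.
  by have /existsP[j Pj] := u_S 0 isT; exists (u 0), j.
have [_ /(_ N Nsat)/leq_trans-> //] := sat_min n P_ex.
pose h (a : 'I_n * 'I_n) : 'I_X * 'I_Y :=
  (Ordinal (collapse_bound eX Xn (ltn_ord a.1)), Ordinal (collapse_bound cY Yn (ltn_ord a.2))).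
rewrite -[X in X * _]card_ord -[Y in _ * Y]card_ord -card_prod /weight.
rewrite -(card_in_imset (f := h)); first exact: max_card.
move=> [i j] [i' j']; rewrite !inE /= => Nij Nij' [hi hj].
congr pair; apply: val_inj.
  exact: (collapse_inj (Ne _ _ Nij) (Ne _ _ Nij') hi).
exact: (collapse_inj (Nc _ _ Nij) (Nc _ _ Nij') hj).
Qed.

End Stretch.

(** * The frame of a compressed matrix *)

Definition pinwheel p q (P : 'M[bool]_(p.+1, q.+1)) t b l r : Prop :=
  [/\ [/\ forall j, P ord0 j = (j == t), forall j, P ord_max j = (j == b),
          forall i, P i ord0 = (i == l) & forall i, P i ord_max = (i == r)]
    & [/\ forall i, P i t = (i == ord0), forall i, P i b = (i == ord_max),
          forall j, P l j = (j == ord0) & forall j, P r j = (j == ord_max)]].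

Definition twisted p q (t b : 'I_q) (l r : 'I_p) : Prop :=
  (t < b /\ r < l) \/ (b < t /\ l < r).

Lemma enumerates_inj n (S : pred 'I_n.+1) p u x x' : enumerates S p u ->
  x <= p -> x' <= p -> u x = u x' -> x = x'.
Proof.
move=> [_ _ u_lt _ _] xp x'p uu; case: (ltngtP x x') => // h.
  by have := u_lt x x' ltac:(lia); rewrite uu ltnn.
by have := u_lt x' x ltac:(lia); rewrite uu ltnn.
Qed.

Lemma enumerates_lt n (S : pred 'I_n.+1) p u x x' : enumerates S p u ->
  x <= p -> x' <= p -> u x < u x' -> x < x'.
Proof.
move=> [_ _ u_lt _ _] xp x'p; case: (ltngtP x x') => [//|h|->]; last by rewrite ltnn.
by have := u_lt x' x ltac:(lia); lia.
Qed.

Lemma compress_frame m k (P : 'M[bool]_(m.+1, k.+1)) (t b : 'I_k.+1) (l r : 'I_m.+1) p q u v :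
  P ord0 ord0 -> pinwheel (set_entry P (ord0, ord0) false) t b l r ->
  t < b -> r < l ->
  enumerates (nonempty_row P) p u -> enumerates (nonempty_col P) q v ->
  exists t' b' l' r', [/\ frame (compress P p q u v) p q t' b' l' r',
    [/\ t' <= q, b' <= q, l' <= p & r' <= p]
    & [/\ v t' = t, v b' = b, u l' = l & u r' = r]].
Proof.
move=> P00 [[Ptop Pbot Pleft Pright] [Pt Pb Pl Pr]] tb rl Hu Hv.
have PE i j : (i, j) != (ord0, ord0) -> P i j = set_entry P (ord0, ord0) false i j.
  by move=> ij; rewrite mxE (negbTE ij).
have t0 : t != ord0 by have := Ptop ord0; rewrite mxE eqxx eq_sym => <-.
have l0 : l != ord0 by have := Pleft ord0; rewrite mxE eqxx eq_sym => <-.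
have b0 : b != ord0 by apply: contraTneq tb => ->.
have r0 : r != ord0.
  apply: contraTneq tb => r0; have := Pr ord_max; rewrite eqxx r0 Ptop => /eqP <-.
  by rewrite -leqNgt leq_ord.
have p0 : ord_max != ord0 :> 'I_m.+1.
  by apply: contraNneq l0 => m0; apply/eqP/val_inj/eqP;
    rewrite /= -leqn0 -[0](congr1 val m0) leq_ord.
have q0 : ord_max != ord0 :> 'I_k.+1.
  by apply: contraNneq t0 => m0; apply/eqP/val_inj/eqP;
    rewrite /= -leqn0 -[0](congr1 val m0) leq_ord.
have sub i j : set_entry P (ord0, ord0) false i j -> P i j.
  by rewrite mxE; case: ifP.
have Pot : P ord0 t by apply: sub; rewrite Ptop.
have Pmb : P ord_max b by apply: sub; rewrite Pbot.
have Plo : P l ord0 by apply: sub; rewrite Pleft.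
have Prm : P r ord_max by apply: sub; rewrite Pright.
have [u0 up u_lt u_S u_onto] := Hu; have [v0 vq v_lt v_S v_onto] := Hv.
have [t' t'q vt] : exists2 y, y <= q & v y = t by apply/v_onto/existsP; exists ord0.
have [b' b'q vb] : exists2 y, y <= q & v y = b by apply/v_onto/existsP; exists ord_max.
have [l' l'p ul] : exists2 x, x <= p & u x = l by apply/u_onto/existsP; exists ord0.
have [r' r'p ur] : exists2 x, x <= p & u x = r by apply/u_onto/existsP; exists ord_max.
exists t', b', l', r'; split=> //; split; rewrite /compress.
- by move=> x y /and3P[].
- move=> x xp; have /existsP[j Pj] := u_S x xp.
  have [y yq vy] : exists2 y, y <= q & v y = j by apply/v_onto/existsP; exists (u x).
  by exists y; rewrite xp yq vy.
- move=> y yq; have /existsP[i Pi] := v_S y yq.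
  have [x xp ux] : exists2 x, x <= p & u x = i by apply/u_onto/existsP; exists (v y).
  by exists x; rewrite xp yq ux.
- by rewrite u0 v0.
- by rewrite t'q u0 vt.
- by rewrite leqnn b'q up vb.
- by rewrite l'p v0 ul.
- by rewrite r'p leqnn ur vq.
- move=> y /and3P[_ yq]; rewrite u0; have [vy0 _|vy0] := eqVneq (v y) ord0.
    by left; apply: (enumerates_inj Hv) => //; rewrite v0.
  rewrite PE ?Ptop; last by rewrite xpair_eqE (negbTE vy0) andbF.
  by move=> /eqP vy; right; apply: (enumerates_inj Hv); rewrite ?vt.
- move=> y /and3P[_ yq]; rewrite up PE ?Pbot.
    by move=> /eqP vy; apply: (enumerates_inj Hv); rewrite ?vb.
  by rewrite xpair_eqE (negbTE p0).
- move=> x /and3P[xp _]; rewrite v0; have [ux0 _|ux0] := eqVneq (u x) ord0.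
    by left; apply: (enumerates_inj Hu) => //; rewrite u0.
  rewrite PE ?Pleft; last by rewrite xpair_eqE (negbTE ux0).
  by move=> /eqP ux; right; apply: (enumerates_inj Hu); rewrite ?ul.
- move=> x /and3P[xp _]; rewrite vq PE ?Pright.
    by move=> /eqP ux; apply: (enumerates_inj Hu); rewrite ?ur.
  by rewrite xpair_eqE (negbTE q0) andbF.
- move=> x /and3P[xp _]; rewrite vt PE ?Pt; last by rewrite xpair_eqE (negbTE t0) andbF.
  by move=> /eqP ux; apply: (enumerates_inj Hu); rewrite ?u0.
- move=> x /and3P[xp _]; rewrite vb PE ?Pb; last by rewrite xpair_eqE (negbTE b0) andbF.
  by move=> /eqP ux; apply: (enumerates_inj Hu); rewrite ?up.
- move=> y /and3P[_ yq]; rewrite ul PE ?Pl; last by rewrite xpair_eqE (negbTE l0).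
  by move=> /eqP vy; apply: (enumerates_inj Hv); rewrite ?v0.
- move=> y /and3P[_ yq]; rewrite ur PE ?Pr; last by rewrite xpair_eqE (negbTE r0).
  by move=> /eqP vy; apply: (enumerates_inj Hv); rewrite ?vq.
- by rewrite lt0n; apply: contraNneq t0 => t'0; rewrite -vt t'0 v0.
- by rewrite lt0n; apply: contraNneq l0 => l'0; rewrite -ul l'0 u0.
Qed.

Definition bounded_sat p q (P : 'M[bool]_(p, q)) : Prop :=
  exists C N, forall n, N <= n -> sat n P <= C.

Lemma bounded_top_left p q (P : 'M[bool]_(p.+1, q.+1)) (t b : 'I_q.+1) (l r : 'I_p.+1) :
  P ord0 ord0 -> pinwheel (set_entry P (ord0, ord0) false) t b l r ->
  t < b -> r < l -> bounded_sat P.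
Proof.
move=> P00 PW tb rl.
have [p' [u Hu]] : exists p' u, enumerates (nonempty_row P) p' u.
  apply: enumerates_exists; apply/existsP; first by exists ord0.
  have [[_ h _ _] _] := PW; exists b; have := h b; rewrite mxE eqxx.
  by case: ifP.
have [q' [v Hv]] : exists q' v, enumerates (nonempty_col P) q' v.
  apply: enumerates_exists; apply/existsP; first by exists ord0.
  have [[_ _ _ h] _] := PW; exists r; have := h r; rewrite mxE eqxx.
  by case: ifP.
have [t' [b' [l' [r' [F [t'q b'q l'p r'p] [vt vb ul ur]]]]]] := compress_frame P00 PW tb rl Hu Hv.
have tb' : t' < b' by apply: (enumerates_lt Hv); rewrite // vt vb.
have rl' : r' < l' by apply: (enumerates_lt Hu); rewrite // ul ur.
have [X [Y [e [c [D W]]]]] := cross_witness_exists (ltn0Sn (maxn p q)) F tb' rl'.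
exists (X * Y), (maxn X Y) => n; rewrite geq_max => /andP[Xn Yn].
by apply: (sat_le_cross Hu Hv _ _ W); rewrite // ltnS leq_max leqnn ?orbT.
Qed.

(** * Symmetries *)

Lemma weight_le_inj m n m' n' (M : 'M[bool]_(m, n)) (M' : 'M[bool]_(m', n'))
    (h : 'I_m * 'I_n -> 'I_m' * 'I_n') :
  injective h -> (forall c, M c.1 c.2 -> M' (h c).1 (h c).2) ->
  weight M <= weight M'.
Proof.
move=> hi hM; rewrite /weight -(card_imset _ hi); apply/subset_leq_card/subsetP.
by move=> _ /imsetP[c + ->]; rewrite !inE => /hM.
Qed.

Lemma contains_tr m n p q (M : 'M[bool]_(m, n)) (P : 'M[bool]_(p, q)) :
  contains M P -> contains M^T P^T.
Proof.
move=> /containsE[f [g [fi gi fg]]]; apply: (containsI gi fi) => i j.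
by rewrite !mxE => /fg.
Qed.

Lemma set_entry_tr m n (M : 'M[bool]_(m, n)) c v :
  (set_entry M c v)^T%R = set_entry M^T (c.2, c.1) v.
Proof. by apply/matrixP => i j; rewrite !mxE -pair_eqE /= andbC. Qed.

Lemma sat_tr n p q (P : 'M[bool]_(p, q)) : (exists i j, P i j) ->
  sat n P <= sat n P^T.
Proof.
move=> Pex; have [i [j Pij]] := Pex.
have [|[M /andP[MP /forallP Mc] <-] _] := sat_min n (P := P^T).
  by exists j, i; rewrite mxE.
have MTsat : saturated P M^T.
  apply/andP; split; first by apply: contra MP => /contains_tr; rewrite trmxK.
  apply/forallP => c; apply/implyP; rewrite mxE => Nc.
  have /implyP/(_ Nc)/contains_tr := Mc (c.2, c.1).
  by rewrite trmxK set_entry_tr; case: c {Nc}.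
have [_ /(_ _ MTsat)/leq_trans-> //] := sat_min n Pex.
apply: (@weight_le_inj _ _ _ _ _ _ (fun c => (c.2, c.1))) => [[? ?] [? ?] [-> ->]//|c].
by rewrite mxE.
Qed.

Definition flip m n (M : 'M[bool]_(m, n)) : 'M[bool]_(m, n) :=
  (\matrix_(i, j) M (rev_ord i) j)%R.

Lemma flipK m n (M : 'M[bool]_(m, n)) : flip (flip M) = M.
Proof. by apply/matrixP => i j; rewrite !mxE rev_ordK. Qed.

Lemma rev_ord_lt n (i j : 'I_n) : (rev_ord i < rev_ord j) = (j < i).
Proof. by have := ltn_ord i; have := ltn_ord j; rewrite /=; lia. Qed.

Lemma contains_flip m n p q (M : 'M[bool]_(m, n)) (P : 'M[bool]_(p, q)) :
  contains M P -> contains (flip M) (flip P).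
Proof.
move=> /containsE[f [g [fi gi fg]]].
apply: (containsI (f := fun i => rev_ord (f (rev_ord i))) _ gi) => [i i' ii|i j].
  by rewrite rev_ord_lt; apply: fi; rewrite rev_ord_lt.
by rewrite !mxE rev_ordK => /fg.
Qed.

Lemma set_entry_flip m n (M : 'M[bool]_(m, n)) c v :
  flip (set_entry M c v) = set_entry (flip M) (rev_ord c.1, c.2) v.
Proof.
apply/matrixP => i j; rewrite !mxE -!pair_eqE /= (can2_eq (@rev_ordK _) (@rev_ordK _)) //.
Qed.

Lemma sat_flip n p q (P : 'M[bool]_(p, q)) : (exists i j, P i j) ->
  sat n P <= sat n (flip P).
Proof.
move=> Pex; have [i [j Pij]] := Pex.
have [|[M /andP[MP /forallP Mc] <-] _] := sat_min n (P := flip P).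
  by exists (rev_ord i), j; rewrite mxE rev_ordK.
have Msat : saturated P (flip M).
  apply/andP; split; first by apply: contra MP => /contains_flip; rewrite flipK.
  apply/forallP => c; apply/implyP; rewrite mxE => Nc.
  have /implyP/(_ Nc)/contains_flip := Mc (rev_ord c.1, c.2).
  by rewrite flipK set_entry_flip rev_ordK; case: c {Nc}.
have [_ /(_ _ Msat)/leq_trans-> //] := sat_min n Pex.
apply: (@weight_le_inj _ _ _ _ _ _ (fun c => (rev_ord c.1, c.2))).
  by apply: can_inj (fun c => (rev_ord c.1, c.2)) _ => -[? ?]; rewrite /= rev_ordK.
by move=> c; rewrite mxE.
Qed.

Definition has_twisted_pinwheel p q (P : 'M[bool]_(p.+1, q.+1)) : Prop :=
  exists t b l r, pinwheel P t b l r /\ twisted t b l r.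

Lemma twisted_pinwheel_tr p q (P : 'M[bool]_(p.+1, q.+1)) :
  has_twisted_pinwheel P -> has_twisted_pinwheel P^T.
Proof.
move=> [t [b [l [r [[[a1 a2 a3 a4] [b1 b2 b3 b4]] tw]]]]].
exists l, r, t, b; split; last by case: tw => -[? ?]; [right|left].
by split; split=> x; rewrite mxE.
Qed.

Lemma rev_ord0 n : rev_ord (ord0 : 'I_n.+1) = ord_max.
Proof. by apply: val_inj; rewrite /= subn1. Qed.

Lemma rev_ord_max n : rev_ord (ord_max : 'I_n.+1) = ord0.
Proof. by rewrite -rev_ord0 rev_ordK. Qed.

Lemma twisted_pinwheel_flip p q (P : 'M[bool]_(p.+1, q.+1)) :
  has_twisted_pinwheel P -> has_twisted_pinwheel (flip P).
Proof.
move=> [t [b [l [r [[[a1 a2 a3 a4] [b1 b2 b3 b4]] tw]]]]].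
have revE i j : (rev_ord i == j :> 'I_p.+1) = (i == rev_ord j).
  by rewrite (can2_eq (@rev_ordK _) (@rev_ordK _)).
exists b, t, (rev_ord l), (rev_ord r); split; last first.
  by rewrite /twisted !rev_ord_lt; case: tw => -[? ?]; [right|left].
split; split=> x; rewrite mxE ?rev_ordK ?rev_ord0 ?rev_ord_max //.
- by rewrite a3 revE.
- by rewrite a4 revE.
- by rewrite b2 revE rev_ord_max.
- by rewrite b1 revE rev_ord0.
Qed.

Definition corner_pinwheel p q (P : 'M[bool]_(p.+1, q.+1)) c : Prop :=
  P c.1 c.2 /\ has_twisted_pinwheel (set_entry P c false).

Lemma bounded_tr p q (P : 'M[bool]_(p.+1, q.+1)) c : corner_pinwheel P c ->
  (corner_pinwheel P^T (c.2, c.1) -> bounded_sat P^T) -> bounded_sat P.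
Proof.
move=> [Pc tw] []; first by split; [rewrite mxE|rewrite -set_entry_tr; exact: twisted_pinwheel_tr].
move=> C [N b]; exists C, N => n /b; apply: leq_trans; apply: sat_tr.
by exists c.1, c.2.
Qed.

Lemma bounded_flip p q (P : 'M[bool]_(p.+1, q.+1)) c : corner_pinwheel P c ->
  (corner_pinwheel (flip P) (rev_ord c.1, c.2) -> bounded_sat (flip P)) -> bounded_sat P.
Proof.
move=> [Pc tw] [].
  by split; [rewrite mxE rev_ordK|rewrite -set_entry_flip; exact: twisted_pinwheel_flip].
move=> C [N b]; exists C, N => n /b; apply: leq_trans; apply: sat_flip.
by exists c.1, c.2.
Qed.

(** Reversing the rows exchanges top and bottom corners, and transposing
    exchanges the two corners on the antidiagonal; once the corner is at the top
    left, transposing keeps it there and exchanges the two orientations. *)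
Lemma bounded_corner p q (P : 'M[bool]_(p.+1, q.+1)) c :
  c \in corners p q -> corner_pinwheel P c -> bounded_sat P.
Proof.
have TL p' q' (P' : 'M[bool]_(p'.+1, q'.+1)) :
    corner_pinwheel P' (ord0, ord0) -> bounded_sat P'.
  move=> H; have [P0 [t [b [l [r [pw [[tb rl]|[bt lr]]]]]]]] := H.
    exact: (bounded_top_left P0 pw tb rl).
  apply: (bounded_tr H) => -[Q0 _]; apply: (@bounded_top_left _ _ _ l r t b) => //.
  rewrite -(set_entry_tr P' (ord0, ord0)).
  case: pw => -[a1 a2 a3 a4] [b1 b2 b3 b4].
  by split; split=> x; rewrite mxE.
have BL p' q' (P' : 'M[bool]_(p'.+1, q'.+1)) :
    corner_pinwheel P' (ord_max, ord0) -> bounded_sat P'.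
  by move=> H; apply: (bounded_flip H); rewrite rev_ord_max; apply: TL.
have TR p' q' (P' : 'M[bool]_(p'.+1, q'.+1)) :
    corner_pinwheel P' (ord0, ord_max) -> bounded_sat P'.
  by move=> H; apply: (bounded_tr H); apply: BL.
rewrite !inE -!orbA => /or4P[] /eqP->; [exact: TL|exact: TR|exact: BL|].
by move=> H; apply: (bounded_flip H); rewrite rev_ord_max; apply: TR.
Qed.

Theorem theorem9p3 (p q : nat) (P : 'M[bool]_(p.+1, q.+1)) (hP : Q2_like P) :
  exists C N : nat, forall n : nat, N <= n -> sat n P <= C.
Proof.
have [c [c_corner Pc [t [b [l [r [outer _ single tw]]]]]]] := hP.
apply: (bounded_corner c_corner); split; first by rewrite Pc.
by exists t, b, l, r.
Qed.
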